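(* Let $\mathbb{F}\in\{\mathbb{R},\mathbb{C}\}$, let $(X,\Sigma,P)$ be a probability space, and let $\mathcal{H}\subseteq\mathbb{F}^X$ be a separable reproducing kernel Hilbert space whose reproducing kernel $K\colon X\times X\to\mathbb{F}$ is measurable. Suppose that $\mathcal{H}_P$ is dense in $\mathcal{H}$. Then, for each $f\in\mathcal{H}$, $$P^{\mathbb{N}}\bigl(\{x\in X^{\mathbb{N}}\mid \pi^n_x f\to f \text{ in } \mathcal{H} \text{ as } n\to\infty\}\bigr)=1,$$ and hence $$P^{\mathbb{N}}\bigl(\{x\in X^{\mathbb{N}}\mid \text{for all } f\in\mathcal{H},\ \pi^n_x f\to f \text{ in } \mathcal{H}\text{ as } n\to\infty\}\bigr)=1.$$
   Context: A Hilbert space $\mathcal{H}\subseteq\mathbb{F}^X$ of functions on $X$ is a reproducing kernel Hilbert space (RKHS) with reproducing kernel $K$ if, writing $K_p:=K(\cdot,p)$, one has $K_p\in\mathcal{H}$ and $f(p)=\langle f,K_p\rangle$ for all $p\in X$ and $f\in\mathcal{H}$. Measurability of $K$ is with respect to the product $\sigma$-algebra $\Sigma\otimes\Sigma$. $P_K$ is the measure on $(X,\Sigma)$ defined by $dP_K(x)=K(x,x)\,dP(x)$. The operator $L_{P,K}\colon L^2(X;P_K)\to\mathcal{H}$ is the bounded linear operator $L_{P,K}\lambda:=\int_X\lambda(x)K_x\,dP(x)$, a Bochner integral in $\mathcal{H}$ (it exists for every $\lambda\in L^2(X;P_K)$). $\mathcal{H}_P:=L_{P,K}(L^2(X;P_K))\subseteq\mathcal{H}$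 is its range. For a sequence $x=(x_i)_{i=1}^\infty\in X^{\mathbb{N}}$ and $n\in\mathbb{N}$, $\pi^n_x$ denotes the orthogonal projection of $\mathcal{H}$ onto $\operatorname{span}\{K_{x_i}\}_{i=1}^n$. $P^{\mathbb{N}}$ is the countable product probability measure on $X^{\mathbb{N}}$ (with the smallest $\sigma$-algebra making all coordinate projections measurable), i.e. the unique probability measure under which the coordinate projections are independent with distribution $P$. *)

(* Defs.v *)
From HB Require Import structures.
From mathcomp Require Import all_boot all_order all_algebra finmap.
From mathcomp Require Import all_classical all_reals all_analysis.
From mathcomp Require Import measurable_realfun complex.

Set Implicit Arguments.
Unset Strict Implicit.
Unset Printing Implicit Defensive.
Import Order.TTheory GRing.Theory Num.Theory.
Import numFieldNormedType.Exports.

Local Open Scope classical_set_scope.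
Local Open Scope ring_scope.

Variant scalar_kind := RealScalars | ComplexScalars.

Definition scalar (R : realType) (k : scalar_kind) : numFieldType :=
  match k with RealScalars => R | ComplexScalars => R[i] end.

Definition scalar_re {R : realType} {k : scalar_kind} : scalar R k -> R :=
  match k with
  | RealScalars => fun z => z
  | ComplexScalars => fun z : R[i] => complex.Re z
  end.

Definition scalar_of_real {R : realType} (k : scalar_kind) : R -> scalar R k :=
  match k with
  | RealScalars => fun r => r
  | ComplexScalars => fun r => real_complex R r
  end.

Definition scalar_conj {R : realType} {k : scalar_kind} :
    scalar R k -> scalar R k :=
  match k with
  | RealScalars => fun z => z
  | ComplexScalars => fun z : R[i] => conjc z
  end.

Lemma scalar_re_ge0 (R : realType) (k : scalar_kind) (z : scalar R k) :
  0 <= z -> 0 <= scalar_re z.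
Proof. by case: k z => //= -[a b]; rewrite lecE/= => /andP[]. Qed.

Lemma scalar_reB (R : realType) (k : scalar_kind) (z w : scalar R k) :
  scalar_re (z - w) = scalar_re z - scalar_re w.
Proof. by case: k z w => //= -[a b] [c e]. Qed.

Lemma scalar_re_le_norm (R : realType) (k : scalar_kind) (z : scalar R k) :
  scalar_of_real k (scalar_re z) <= `|z|.
Proof.
case: k z => /= [z|z]; first exact: ler_norm.
by apply: le_trans (normc_ge_Re z); rewrite lecR ler_norm.
Qed.

Lemma scalar_of_real_lt (R : realType) (k : scalar_kind) (a b : R) :
  (scalar_of_real k a < scalar_of_real k b) = (a < b).
Proof. by case: k => //=; rewrite ltcR. Qed.

(* A norm over [scalar R k] takes its values in [scalar R k]; this is the
   corresponding element of [R]. *)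
Definition rnorm {R : realType} {k : scalar_kind}
    {V : normedModType (scalar R k)} (v : V) : R := scalar_re `|v|.

Definition borel (T : ptopologicalType) := g_sigma_algebraType (@open T).

Lemma measurable_scalar_re (R : realType) (k : scalar_kind) :
  measurable_fun [set: borel (scalar R k)]
    (scalar_re : borel (scalar R k) -> R).
Proof.
apply: (measurability _ (RGenOInfty.measurableE R)) => _ [_ [a ->] <-].
rewrite setTI; apply: sub_sigma_algebra.
apply: (_ : open [set z : scalar R k | scalar_re z \in `]a, +oo[]).
rewrite openE => z /=; rewrite in_itv/= andbT => az.
apply/nbhs_ballP; exists (scalar_of_real k (scalar_re z - a)) => /=.
  by rewrite (_ : 0 = scalar_of_real k 0) ?scalar_of_real_lt ?subr_gt0 //; case: (k).
move=> w; rewrite /ball/= => zw; rewrite in_itv/= andbT.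
have := le_lt_trans (scalar_re_le_norm (z - w)) zw.
by rewrite scalar_of_real_lt scalar_reB ltrD2l ltrN2.
Qed.

Definition separable (T : topologicalType) :=
  exists2 D : set T, countable D & dense D.

(* The elements of the space are identified with functions through the
   injective linear map [rkhs_fun]; [kernel_at p] is the element of the space
   whose function is [K (., p)]. The form [rkhs_dot] is linear in its first
   argument and conjugate-linear in the second one. *)
Record rkhs (R : realType) (k : scalar_kind) (X : Type) := RKHS {
  rkhs_space :> completeNormedModType (scalar R k) ;
  rkhs_dot : {dot rkhs_space for @scalar_conj R k} ;
  rkhs_normE : forall f : rkhs_space, `|f| ^+ 2 = rkhs_dot f f ;
  rkhs_fun : {linear rkhs_space -> (X -> (scalar R k)^o)} ;
  rkhs_fun_inj : injective rkhs_fun ;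
  rkhs_kernel : X * X -> scalar R k ;
  kernel_at : X -> rkhs_space ;
  kernel_atE : forall p q, rkhs_fun (kernel_at p) q = rkhs_kernel (q, p) ;
  reproducing : forall f p, rkhs_fun f p = rkhs_dot f (kernel_at p)
}.
Arguments rkhs_kernel {R k X} H : rename.
Arguments kernel_at {R k X} H : rename.

Definition measurable_rkhs_kernel (R : realType) (k : scalar_kind)
    (d : measure_display) (X : measurableType d) (H : rkhs R k X) :=
  measurable_fun [set: X * X] (rkhs_kernel H : X * X -> borel (scalar R k)).

Section kernel_measure.
Context {R : realType} {k : scalar_kind} {d : measure_display}.
Context {X : measurableType d} (P : probability X R) (H : rkhs R k X).
Local Open Scope ereal_scope.

(* [K (x, x)] is the square of the norm of [K_x], a nonnegative real. *)
Definition kernel_diag (x : X) : \bar R := (scalar_re (rkhs_kernel H (x, x)))%:E.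

Lemma kernel_diag_ge0 x : 0 <= kernel_diag x.
Proof.
rewrite lee_fin; apply: scalar_re_ge0.
by rewrite -kernel_atE reproducing -rkhs_normE exprn_ge0.
Qed.

Definition kernel_measure (mK : measurable_rkhs_kernel H) (A : set X) : \bar R :=
  \int[P]_(x in A) kernel_diag x.

Variable mK : measurable_rkhs_kernel H.

Lemma measurable_kernel_diag : measurable_fun [set: X] kernel_diag.
Proof.
apply/measurable_EFinP.
apply: (@measurableT_comp _ _ _ _ _ _ (scalar_re : borel (scalar R k) -> R)
  _ (fun x => rkhs_kernel H (x, x) : borel (scalar R k))).
  exact: measurable_scalar_re.
apply: (@measurableT_comp _ _ _ _ _ _
  (rkhs_kernel H : X * X -> borel (scalar R k)) _ (fun x => (x, x))) => //.
exact: measurable_fun_pair.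
Qed.

Let kernel_measure0 : kernel_measure mK set0 = 0.
Proof. exact: integral_set0. Qed.

Let kernel_measure_ge0 A : 0 <= kernel_measure mK A.
Proof. by apply: integral_ge0 => x _; exact: kernel_diag_ge0. Qed.

Let kernel_measure_sigma_additive : semi_sigma_additive (kernel_measure mK).
Proof.
apply: semi_sigma_additive_nng_induced kernel_diag_ge0.
exact: measurable_kernel_diag.
Qed.

HB.instance Definition _ := isMeasure.Build _ _ _ (kernel_measure mK)
  kernel_measure0 kernel_measure_ge0 kernel_measure_sigma_additive.

End kernel_measure.

Section bochner.
Context {R : realType} {k : scalar_kind} {d : measure_display}.
Context {X : measurableType d} (P : probability X R).
Context {V : completeNormedModType (scalar R k)}.

Definition simple_integral (s : {fimfun X >-> V}) : V :=
  \sum_(v \in range s) scalar_of_real k (fine (P (s @^-1` [set v]))) *: v.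

Definition is_bochner_integral (g : X -> V) (v : V) :=
  exists s : nat -> {fimfun X >-> V},
    [/\ forall n u, measurable (s n @^-1` [set u]),
        {ae P, forall x, (fun n => s n x) @ \oo --> g x},
        (fun n => \int[P]_x (rnorm (g x - s n x))%:E)%E @ \oo --> 0%E
      & (fun n => simple_integral (s n)) @ \oo --> v].

(* The default value [0] is taken when [g] is not Bochner integrable. *)
Definition bochner_integral (g : X -> V) : V :=
  xget 0 (is_bochner_integral g).

End bochner.

Section range_of_integral_operator.
Context {R : realType} {k : scalar_kind} {d : measure_display}.
Context {X : measurableType d}.

(* Functions rather than classes modulo almost everywhere equality. *)
Definition L2 (mu : {measure set X -> \bar R}) : set (X -> scalar R k) :=
  [set l | measurable_fun [set: X] (l : X -> borel (scalar R k)) /\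
           finite_norm mu 2%:E (fun x => rnorm (l x : (scalar R k)^o))].

Context (P : probability X R) (H : rkhs R k X).

Definition kernel_operator (l : X -> scalar R k) : H :=
  bochner_integral P (fun x => l x *: kernel_at H x).

Definition kernel_operator_range (mK : measurable_rkhs_kernel H) : set H :=
  kernel_operator @` L2 (kernel_measure P mK).

End range_of_integral_operator.

Section projection.
Context {R : realType} {k : scalar_kind} {X : Type} {H : rkhs R k X}.

Definition kernel_span (x : nat -> X) (n : nat) : set H :=
  [set v | exists c : 'I_n -> scalar R k,
             v = \sum_(i < n) c i *: kernel_at H (x i)].

(* The orthogonal projection exists and is unique when [V] is a closed
   subspace, in particular when [V] is finite-dimensional. *)
Definition orth_proj (V : set H) (f : H) : H :=
  xget 0 [set g | V g /\ forall v, V v -> rkhs_dot H (f - g) v = 0].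

End projection.

Definition seq_space (d : measure_display) (X : measurableType d) :=
  g_sigma_algebraType
    (\bigcup_i preimage_set_system [set: nat -> X] (fun x => x i) measurable).

(* [Q] is the law under which the coordinates are independent with
   distribution [P]; these two properties determine [Q]. *)
Definition is_countable_power (R : realType) (d : measure_display)
    (X : measurableType d) (P : probability X R)
    (Q : probability (seq_space X) R) :=
  (forall i (A : set X), measurable A ->
     Q [set x : seq_space X | A (x i)] = P A) /\
  (forall (J : {fset nat}) (A : nat -> set X),
     (forall i, measurable (A i)) ->
     Q [set x : seq_space X | forall i, i \in J -> A i (x i)] =
     (\prod_(i <- J) Q [set x : seq_space X | A i (x i)])%E).

(* Main.v *)
(* For a sample x let W_x be the closed span of the K_(x i), so that pi^n_x f
   converges to f if and only if f is in W_x. By separability the image of p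
   |-> K_p has a countable base of balls; by independence the sample almost
   surely visits every ball of positive probability, and the remaining balls
   form a null set. Hence almost surely K_p lies in W_x for P-almost every p.
   Bochner integrals of functions with values almost everywhere in a closed
   subspace stay in it, so W_x contains H_P, which is dense, and W_x = H.
   As the two events must be shown measurable, they are written with countably
   many norm inequalities between finite combinations of the K_(x i) with
   rational coefficients; p |-> K_p is weakly measurable because the e such
   that <K_p, e> is measurable form a closed subspace containing every K_q, to
   which the previous argument applies. *)
Require Import Defs.
From mathcomp Require Import all_boot all_order all_algebra.
From mathcomp Require Import all_classical all_reals all_analysis.
From mathcomp Require Import finmap measurable_realfun complex.
From mathcomp Require Import ring lra.
Set Implicit Arguments.
Unset Strict Implicit.
Unset Printing Implicit Defensive.
Import Order.TTheory GRing.Theory Num.Theory.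
Import numFieldNormedType.Exports.
Local Open Scope classical_set_scope.
Local Open Scope ring_scope.
Local Notation scalar := Defs.scalar.

(** * Real and complex scalars handled uniformly *)

Section scalars.
Context {R : realType} {k : scalar_kind}.
Implicit Types (z w : scalar R k) (r : R).

Lemma scalar_ofK : cancel (scalar_of_real k : R -> scalar R k) scalar_re.
Proof. by case: k. Qed.

Lemma ge0_scalarE z : 0 <= z -> z = scalar_of_real k (scalar_re z).
Proof. by case: k z => //= -[a b]; rewrite lecE /= => /andP[/eqP -> _]. Qed.

Lemma scalar_of_real_le r s :
  (scalar_of_real k r <= scalar_of_real k s) = (r <= s).
Proof. by case: k => //=; rewrite lecR. Qed.

Lemma scalar_of_realD r s :
  scalar_of_real k (r + s) = scalar_of_real k r + scalar_of_real k s.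
Proof. by case: k => //=; rewrite raddfD. Qed.

Lemma scalar_of_realM r s :
  scalar_of_real k (r * s) = scalar_of_real k r * scalar_of_real k s.
Proof. by case: k => //=; rewrite rmorphM. Qed.

Lemma scalar_of_real0 : scalar_of_real k 0 = 0 :> scalar R k.
Proof. by case: k. Qed.

Lemma scalar_reD z w : scalar_re (z + w) = scalar_re z + scalar_re w.
Proof. by case: k z w => //= -[a b] [c e]. Qed.

Lemma scalar_reN z : scalar_re (- z) = - scalar_re z.
Proof. by case: k z => //= -[a b]. Qed.

Lemma scalar_re_ofM r z : scalar_re (scalar_of_real k r * z) = r * scalar_re z.
Proof. by case: k z => //= -[a b] /=; rewrite mul0r subr0. Qed.

Lemma scalar_re_conj z : scalar_re (scalar_conj z) = scalar_re z.
Proof. by case: k z => //= -[a b]. Qed.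

Lemma scalar_conjK : involutive (@scalar_conj R k).
Proof. by case: k => //= z; rewrite conjcK. Qed.

Lemma scalar_conj0 : scalar_conj (0 : scalar R k) = 0.
Proof. by case: k => //=; rewrite /scalar_conj; exact: (@conjc0 R). Qed.

End scalars.

(** * Real-valued norms, metric closure and linear subspaces *)

Section rnorm.
Context {R : realType} {k : scalar_kind} {V : normedModType (scalar R k)}.
Implicit Types (u v w : V) (r : R).

Lemma rnormE v : `|v| = scalar_of_real k (rnorm v).
Proof. exact/ge0_scalarE/normr_ge0. Qed.

Lemma rnorm_ge0 v : 0 <= rnorm v.
Proof. exact/scalar_re_ge0/normr_ge0. Qed.

Lemma rnorm0 : rnorm (0 : V) = 0.
Proof. by rewrite /rnorm normr0 -(scalar_of_real0 (k := k)) scalar_ofK. Qed.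

Lemma rnorm_eq0 v : rnorm v = 0 -> v = 0.
Proof.
by move=> v0; apply/normr0_eq0; rewrite rnormE v0 scalar_of_real0.
Qed.

Lemma rnormN v : rnorm (- v) = rnorm v.
Proof. by rewrite /rnorm normrN. Qed.

Lemma rdistC u v : rnorm (u - v) = rnorm (v - u).
Proof. by rewrite -rnormN opprB. Qed.

Lemma rnormD u v : rnorm (u + v) <= rnorm u + rnorm v.
Proof.
by rewrite -(scalar_of_real_le (k := k)) scalar_of_realD -!rnormE ler_normD.
Qed.

Lemma rdist_triangle w u v : rnorm (u - v) <= rnorm (u - w) + rnorm (w - v).
Proof. by rewrite -[u - v](subrKA w) rnormD. Qed.

Lemma rnormZ (c : scalar R k) v :
  rnorm (c *: v) = rnorm (c : (scalar R k)^o) * rnorm v.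
Proof.
by rewrite /rnorm normrZ {1}(ge0_scalarE (normr_ge0 c)) scalar_re_ofM.
Qed.

Lemma rnorm_ofZ r v : 0 <= r -> rnorm (scalar_of_real k r *: v) = r * rnorm v.
Proof.
move=> r0; rewrite /rnorm normrZ ger0_norm ?scalar_re_ofM //.
by rewrite -(scalar_of_real0 (k := k)) scalar_of_real_le.
Qed.

Lemma rnorm_sum I (s : seq I) (F : I -> V) :
  rnorm (\sum_(i <- s) F i) <= \sum_(i <- s) rnorm (F i).
Proof.
elim: s => [|i s IHs]; first by rewrite !big_nil rnorm0.
by rewrite !big_cons (le_trans (rnormD _ _)) // lerD2l.
Qed.

Lemma rnorm_cvgP (u : nat -> V) v :
  (u @ \oo --> v) <->
  forall e : R, 0 < e -> \forall n \near \oo, rnorm (v - u n) < e.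
Proof.
split=> [uv e e0|uv].
  have /cvgrPdist_lt := uv.
  move=> /(_ (scalar_of_real k e)); rewrite -(scalar_of_real0 (k := k)).
  rewrite scalar_of_real_lt => /(_ e0); apply: filterS => n.
  by rewrite rnormE scalar_of_real_lt.
(* A positive scalar is the image of its real part, also over the complex numbers, so real radii are
   enough. *)
apply/cvgrPdist_lt => e e0; rewrite [e]ge0_scalarE ?(ltW e0) //.
have : 0 < scalar_re e.
  by rewrite -(scalar_of_real_lt k) -ge0_scalarE ?(ltW e0) // scalar_of_real0.
move=> /uv; apply: filterS => n.
by rewrite rnormE scalar_of_real_lt.
Qed.

Lemma dense_rnorm (D : set V) v (e : R) :
  dense D -> 0 < e -> exists2 w, D w & rnorm (v - w) < e.
Proof.
move=> dD e0; have E0 : 0 < scalar_of_real k e.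
  by rewrite -(scalar_of_real0 (k := k)) scalar_of_real_lt.
have [] := dD (ball v (scalar_of_real k e)).
- by exists v; exact: ballxx.
- exact: ball_open.
- move=> w [+ Dw]; rewrite -ball_normE /= rnormE scalar_of_real_lt => vw.
  by exists w.
Qed.

(** Metric closure with real radii, so that it combines directly with estimates between real
    integrals. *)
Definition rclosure (A : set V) : set V :=
  [set v | forall e : R, 0 < e -> exists2 w, A w & rnorm (v - w) < e].

Definition lin_subspace (W : set V) :=
  [/\ W 0, forall u v, W u -> W v -> W (u + v) &
      forall (c : scalar R k) v, W v -> W (c *: v)].

Lemma sub_rclosure A : A `<=` rclosure A.
Proof. by move=> v Av e e0; exists v => //; rewrite subrr rnorm0. Qed.

Lemma rclosureK A : rclosure (rclosure A) `<=` rclosure A.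
Proof.
move=> v Av e e0; have e20 : 0 < e / 2 by rewrite divr_gt0.
have [w Aw vw] := Av _ e20; have [t At wt] := Aw _ e20.
exists t => //; rewrite (le_lt_trans (rdist_triangle w _ _)) //.
by rewrite (splitr e) ltrD.
Qed.

Lemma lin_subspace_rclosure W : lin_subspace W -> lin_subspace (rclosure W).
Proof.
move=> [W0 WD WZ]; split=> [|u v Wu Wv e e0|c v Wv e e0].
- exact: sub_rclosure.
- have e20 : 0 < e / 2 by rewrite divr_gt0.
  have [u' Wu' uu'] := Wu _ e20; have [v' Wv' vv'] := Wv _ e20.
  exists (u' + v'); first exact: WD.
  rewrite (_ : _ - _ = (u - u') + (v - v')); last by rewrite opprD addrACA.
  by rewrite (le_lt_trans (rnormD _ _)) // (splitr e) ltrD.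
- set a := rnorm (c : (scalar R k)^o).
  have a0 : 0 <= a by exact/scalar_re_ge0/normr_ge0.
  have a1 : 0 < a + 1 by rewrite ltr_wpDl.
  (* Dividing by [a + 1] instead of [a] includes the case [c = 0]. *)
  have [w Ww vw] := Wv (e / (a + 1)) (divr_gt0 e0 a1).
  exists (c *: w); first exact: WZ.
  rewrite -scalerBr rnormZ -/a; rewrite ltr_pdivlMr // in vw.
  rewrite (le_lt_trans _ vw) // mulrC ler_wpM2l ?rnorm_ge0 //.
  by rewrite lerDl.
Qed.

Lemma lin_subspace_sum W I (s : seq I) (F : I -> V) :
  lin_subspace W -> (forall i, W (F i)) -> W (\sum_(i <- s) F i).
Proof.
move=> [W0 WD _] WF; elim: s => [|i s IHs]; first by rewrite big_nil.
by rewrite big_cons; exact: WD.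
Qed.

End rnorm.

(** * Bochner integrals of functions with values in a closed subspace *)

Section bochner_integral_closed.
Context {R : realType} {k : scalar_kind} {d : measure_display}.
Context {X : measurableType d} (P : probability X R).

(** The integral of a nonnegative function is a supremum over the simple functions below it, hence
    monotone even without measurability. This matters because [is_bochner_integral] gives no
    measurability of the integrand [rnorm (g x - s n x)]. *)
Lemma ge0_le_integralT (f g : X -> \bar R) :
  (forall x, 0 <= f x)%E -> (forall x, f x <= g x)%E ->
  (\int[P]_x f x <= \int[P]_x g x)%E.
Proof.
move=> f0 fg; rewrite !ge0_integralTE //; last first.
  by move=> x; exact: le_trans (fg x).
apply: le_ereal_sup => _ [h hf <-]; exists h => // x.
exact: le_trans (fg x).
Qed.

Lemma ae_le_integralT (f g : X -> \bar R) (N : set X) :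
  measurable N -> P N = 0%E -> measurable_fun setT f ->
  (forall x, 0 <= f x)%E -> (forall x, 0 <= g x)%E ->
  (forall x, ~ N x -> f x <= g x)%E ->
  (\int[P]_x f x <= \int[P]_x g x)%E.
Proof.
move=> mN PN0 mf f0 g0 fg.
rewrite (ge0_negligible_integral mN) // integral_mkcond.
apply: ge0_le_integralT => x; rewrite patchE; case: ifPn => // xN.
by apply: fg; case: (set_mem xN).
Qed.

Context {V : completeNormedModType (scalar R k)}.

Section simple.
Variable s : {fimfun X >-> V}.
Hypothesis ms : forall u, measurable (s @^-1` [set u]).

Lemma comp_fimfunE (c : V -> R) x :
  (c (s x))%:E =
  (\sum_(v <- fset_set (range s)) (c v * \1_(s @^-1` [set v]) x)%:E)%E.
Proof.
have sx : s x \in fset_set (range s).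
  by rewrite in_fset_set; [apply/mem_set; exists x | exact: fimfunP].
rewrite (big_fsetD1 _ sx) /= big1_fset ?adde0.
  by rewrite indicE mem_set // mulr1.
move=> v; rewrite !inE => /andP[/eqP vsx _] _.
by rewrite indicE memNset ?mulr0 //= => sxv; apply: vsx.
Qed.

Lemma measurable_comp_fimfun (c : V -> R) :
  measurable_fun setT (fun x => (c (s x))%:E).
Proof.
under eq_fun do rewrite comp_fimfunE.
apply: emeasurable_sum => v; apply/measurable_EFinP/measurable_funM => //.
Qed.

Lemma integral_comp_fimfun (c : V -> R) : (forall v, 0 <= c v) ->
  (\int[P]_x (c (s x))%:E =
  (\sum_(v <- fset_set (range s)) c v * fine (P (s @^-1` [set v])))%:E)%E.
Proof.
move=> c0; under eq_integral do rewrite comp_fimfunE.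
rewrite ge0_integral_sum //; last first.
- by move=> v x _; rewrite lee_fin mulr_ge0.
- move=> v; exact/measurable_EFinP/measurable_funM.
rewrite -sumEFin; apply: eq_bigr => v _.
rewrite (@integralZl_indic _ _ _ P _ measurableT (fun=> s @^-1` [set v])) //.
  by rewrite integral_indic // setIT EFinM fineK // fin_num_measure.
by move=> cv0; have := c0 v; rewrite leNgt cv0.
Qed.

End simple.

(* Replacing each value of a simple approximation by an almost nearest point of
   [W] moves its integral by about the integral of the distance of the
   approximation to [W], which is at most its distance to [g]. *)
Lemma bochner_integral_mem (W : set V) (g : X -> V) (N : set X) :
  lin_subspace W -> rclosure W `<=` W -> measurable N -> P N = 0%E ->
  (forall x, ~ N x -> W (g x)) -> W (bochner_integral P g).
Proof.
move=> linW clW mN PN0 Wg; have [W0 WD WZ] := linW.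
(* If [g] has no Bochner integral, the value is the default 0, which lies in [W]. *)
rewrite /bochner_integral; case: xgetP => [v _ [s [ms _ gs sv]]|//].
(* Three errors of at most [e / 4] will be added: from [v] to the simple integral, the mean distance
   of the simple function to [W], and the slack in choosing almost nearest points. *)
apply: clW => e e0; have e30 : 0 < e / 4 by rewrite divr_gt0.
pose dist u : R := inf [set rnorm (u - w) | w in W].
have lbW u : has_lbound [set rnorm (u - w) | w in W].
  by exists 0 => _ [w _ <-]; exact: rnorm_ge0.
have neW u : [set rnorm (u - w) | w in W] !=set0.
  by exists (rnorm (u - 0)), 0.
have dist_ge0 u : 0 <= dist u.
  by apply: lb_le_inf => // _ [w _ <-]; exact: rnorm_ge0.
have dist_le u w : W w -> dist u <= rnorm (u - w).
  by move=> Ww; apply: ge_inf => //; exists w.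
have /choice[w wP] u : exists w, W w /\ rnorm (u - w) < dist u + e / 4.
  by have [_ [w Ww <-] uw] := inf_adherent e30 (conj (neW u) (lbW u)); exists w.
have [n [gsn svn]] : exists n,
    (\int[P]_x (rnorm (g x - s n x))%:E < (e / 4)%:E)%E /\
    rnorm (v - simple_integral P (s n)) < e / 4.
  move/fine_cvgP : gs => [gfin /(@cvgr_lt R)/(_ _ e30) gs].
  have /rnorm_cvgP/(_ _ e30) sv' := sv.
  have [n _ nP] := filterI gfin (filterI gs sv').
  have [/= fin [lt1 lt2]] := nP n (leqnn n).
  by exists n; split => //; rewrite -(fineK fin) lte_fin.
pose mass u : R := fine (P (s n @^-1` [set u])).
pose E := fset_set (range (s n)).
have mass_ge0 u : 0 <= mass u by exact: fine_ge0.
exists (\sum_(u <- E) scalar_of_real k (mass u) *: w u).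
  by apply: lin_subspace_sum => // u; apply: WZ; case: (wP u).
(* The fibres of [s n] have total mass 1, so the slack [e / 4] allowed at each value also averages
   to [e / 4]. *)
have mass1 : \sum_(u <- E) mass u = 1.
  apply: EFin_inj.
  have := @integral_comp_fimfun (s n) (ms n) (fun=> 1) (fun=> ler01).
  under eq_bigr do rewrite mul1r.
  by move=> <-; rewrite integral_cst // mul1e; exact: probability_setT.
have massd : \sum_(u <- E) dist u * mass u <= e / 4.
  rewrite -lee_fin -integral_comp_fimfun // (le_trans _ (ltW gsn)) //.
  apply: (@ae_le_integralT _ _ N) => //.
  - exact: measurable_comp_fimfun.
  - by move=> x; rewrite lee_fin.
  - by move=> x; rewrite lee_fin rnorm_ge0.
  - by move=> x Nx; rewrite lee_fin rdistC dist_le //; exact: Wg.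
rewrite (le_lt_trans (rdist_triangle (simple_integral P (s n)) _ _)) //.
rewrite {2}/simple_integral fsbig_finite; last exact: fimfunP.
rewrite -/E -sumrB.
under [in X in _ + rnorm X]eq_bigr do rewrite -scalerBr.
have le2 : rnorm (\sum_(u <- E) scalar_of_real k (mass u) *: (u - w u)) <=
    e / 4 + e / 4.
  apply: le_trans (rnorm_sum _ _) _.
  apply: (@le_trans _ _ (\sum_(u <- E) (dist u * mass u + e / 4 * mass u))).
    apply: ler_sum => u _; rewrite rnorm_ofZ // -mulrDl mulrC ler_wpM2r //.
    by apply: ltW; case: (wP u).
  by rewrite big_split /= -mulr_sumr mass1 mulr1 lerD2r.
by move: le2 svn; rewrite /mass; lra.
Qed.

End bochner_integral_closed.

(** * Inner products, orthogonal projections and spans of kernel functions *)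

Section inner_product.
Context {R : realType} {k : scalar_kind} {X : Type} (H : rkhs R k X).
Local Notation dot := (rkhs_dot H).
Implicit Types (f g u v a : H) (c : scalar R k).

(** The real part is a real scalar product inducing the same norm, so order arguments apply to both
    scalar fields alike. *)
Definition rdot u v : R := scalar_re (dot u v).

Lemma dotDl u v w : dot (u + v) w = dot u w + dot v w.
Proof. exact: linearDl. Qed.

Lemma dotBl u v w : dot (u - v) w = dot u w - dot v w.
Proof. exact: linearBl. Qed.

Lemma dotZl c u v : dot (c *: u) v = c * dot u v.
Proof. exact: linearZl_LR. Qed.

Lemma dotDr u v w : dot u (v + w) = dot u v + dot u w.
Proof. exact: linearDr. Qed.

Lemma dotZr c u v : dot u (c *: v) = scalar_conj c * dot u v.
Proof. exact: linearZr_LR. Qed.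

Lemma dotC u v : dot u v = scalar_conj (dot v u).
Proof.
by have := @hermitian_subproof _ _ _ _ dot u v; rewrite expr0 mul1r.
Qed.

Lemma dot_eq0C u v : dot u v = 0 -> dot v u = 0.
Proof. by move=> uv0; rewrite dotC uv0 scalar_conj0. Qed.

Lemma rdotDl u v w : rdot (u + v) w = rdot u w + rdot v w.
Proof. by rewrite /rdot dotDl scalar_reD. Qed.

Lemma rdotC u v : rdot u v = rdot v u.
Proof. by rewrite /rdot dotC scalar_re_conj. Qed.

Lemma rdotDr u v w : rdot u (v + w) = rdot u v + rdot u w.
Proof. by rewrite rdotC rdotDl !(rdotC u). Qed.

Lemma rdotZl c u v : rdot (c *: u) v = rdot u (scalar_conj c *: v).
Proof. by rewrite /rdot dotZl dotZr scalar_conjK. Qed.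

Lemma rdotNl u v : rdot (- u) v = - rdot u v.
Proof. by rewrite /rdot linearNl scalar_reN. Qed.

Lemma rdotNr u v : rdot u (- v) = - rdot u v.
Proof. by rewrite rdotC rdotNl rdotC. Qed.

Lemma rdot_ofZl (r : R) u v : rdot (scalar_of_real k r *: u) v = r * rdot u v.
Proof. by rewrite /rdot dotZl scalar_re_ofM. Qed.

Lemma rdotvv v : rdot v v = rnorm v ^+ 2.
Proof.
by rewrite /rdot -rkhs_normE rnormE expr2 -scalar_of_realM scalar_ofK expr2.
Qed.

Lemma rnormD_sqr u v :
  rnorm (u + v) ^+ 2 = rnorm u ^+ 2 + rdot u v *+ 2 + rnorm v ^+ 2.
Proof. by rewrite -!rdotvv rdotDl !rdotDr (rdotC v u); ring. Qed.

(** Cauchy-Schwarz: the squared norm of |v| u - ([rdot u v] / |v|) v is nonnegative and equals (|u|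
    |v|)^2 - ([rdot u v])^2. *)
Lemma rdot_le_norm u v : rdot u v <= rnorm u * rnorm v.
Proof.
have [->|v0] := eqVneq v 0.
  by rewrite /rdot linear0r rnorm0 mulr0 -(scalar_of_real0 (k := k)) scalar_ofK.
have v_gt0 : 0 < rnorm v.
  rewrite lt_neqAle rnorm_ge0 andbT eq_sym.
  by apply: contra_neq v0; exact: rnorm_eq0.
have := sqr_ge0 (rnorm (scalar_of_real k (rnorm v) *: u
   + scalar_of_real k (- (rdot u v / rnorm v)) *: v)).
rewrite rnormD_sqr -!rdotvv !rdot_ofZl ![rdot _ (_ *: _)]rdotC !rdot_ofZl.
rewrite !rdotvv (rdotC v u).
rewrite [leRHS](_ : _ = (rnorm u * rnorm v) ^+ 2 - rdot u v ^+ 2); last first.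
  by field; rewrite gt_eqF.
rewrite subr_ge0 => le; have p0 := mulr_ge0 (rnorm_ge0 u) (rnorm_ge0 v).
by case: (lerP (rdot u v) (rnorm u * rnorm v)) => // lt; nra.
Qed.

(** For such [V] the default value 0 in [orth_proj] is never resorted to. *)
Definition projectable (V : set H) := forall f,
  exists g, V g /\ forall v, V v -> dot (f - g) v = 0.

(** A Gram-Schmidt step. Subtracting from [a] its projection [a'] leaves [b] orthogonal to [V]. If
    [b = 0] the subspace does not grow; otherwise the projection of [f] gains the component of [f]
    along [b]. *)
Lemma projectable_add V a : lin_subspace V -> projectable V ->
  projectable [set u + c *: a | u in V & c in setT].
Proof.
move=> [V0 VD VZ] pV.
have VN u : V u -> V (- u) by rewrite -scaleN1r; exact: VZ.
have [a' [Va' a'P]] := pV a; pose b := a - a'.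
have [b0 f|b0 f] := eqVneq b 0.
  have [g [Vg gP]] := pV f; exists g; split.
    by exists g => //; exists 0 => //; rewrite scale0r addr0.
  move=> _ [u Vu [c _ <-]]; apply: gP; apply: VD => //; apply: VZ.
  by rewrite -[a](subrK a') -/b b0 add0r.
have [g [Vg gP]] := pV f.
have bb : dot b b != 0 by rewrite gt_eqF // neq0_dnorm_gt0.
have bg : dot b g = 0 by exact: a'P.
pose c := dot f b / dot b b.
exists (g + c *: b); split.
  (* Membership in the enlarged subspace: g + c b = (g - c a') + c a. *)
  exists (g - c *: a'); first by apply: VD => //; apply/VN/VZ.
  by exists c => //; rewrite /b scalerBr addrA addrAC.
have gb0 : dot (f - (g + c *: b)) b = 0.
  by rewrite dotBl dotDl dotZl (dot_eq0C bg) add0r divfK ?subrr.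
have gV0 v : V v -> dot (f - (g + c *: b)) v = 0.
  by move=> Vv; rewrite opprD addrA dotBl gP // dotZl a'P // mulr0 subr0.
move=> _ [u Vu [e _ <-]].
have -> : u + e *: a = u + e *: a' + e *: b.
  by rewrite /b scalerBr -addrA [e *: a' + _]addrC subrK.
by rewrite !dotDr !dotZr gb0 !gV0 // !mulr0 !addr0.
Qed.

Lemma lin_subspace_kernel_span (x : nat -> X) n :
  lin_subspace (kernel_span (H := H) x n).
Proof.
split=> [|_ _ [c ->] [e ->]|a _ [c ->]].
- by exists (fun=> 0); rewrite big1 // => i _; rewrite scale0r.
- exists (fun i => c i + e i); rewrite -big_split.
  by apply: eq_bigr => i _; rewrite scalerDl.
- exists (fun i => a * c i); rewrite scaler_sumr.
  by apply: eq_bigr => i _; rewrite scalerA.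
Qed.

Lemma kernel_spanS (x : nat -> X) n :
  kernel_span (H := H) x n.+1 =
  [set u + c *: kernel_at H (x n) | u in kernel_span x n & c in setT].
Proof.
apply/seteqP; split=> [_ [c ->]|_ [_ [c ->] [e _ <-]]].
  exists (\sum_(i < n) c (widen_ord (leqnSn n) i) *: kernel_at H (x i)).
    by exists (fun i => c (widen_ord (leqnSn n) i)).
  by exists (c ord_max) => //; rewrite big_ord_recr.
exists (fun i => if unlift ord_max i is Some j then c j else e).
rewrite big_ord_recr /= unlift_none; congr (_ + _).
apply: eq_bigr => i _; rewrite (_ : widen_ord _ i = lift ord_max i) ?liftK //.
by apply: val_inj; rewrite /= /bump leqNgt ltn_ord.
Qed.

Lemma projectable_kernel_span (x : nat -> X) n : projectable (kernel_span x n).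
Proof.
elim: n => [f|n IHn].
  exists 0; split; first by exists (fun=> 0); rewrite big_ord0.
  by move=> _ [c ->]; rewrite big_ord0 linear0r.
rewrite kernel_spanS; apply: projectable_add => //.
exact: lin_subspace_kernel_span.
Qed.

Lemma orth_proj_mem V f : projectable V -> V (orth_proj V f).
Proof. by move=> pV; have [] := xgetPex 0 (pV f). Qed.

(** Pythagoras: [f - g] is orthogonal to [g - v], so |f - v|^2 = |f - g|^2 + |g - v|^2. *)
Lemma orth_proj_le V f v : lin_subspace V -> projectable V -> V v ->
  rnorm (f - orth_proj V f) <= rnorm (f - v).
Proof.
move=> [V0 VD VZ] pV Vv; have [] := xgetPex 0 (pV f).
rewrite -/(orth_proj V f); set g := orth_proj V f => Vg gP.
have gv : rdot (f - g) (g - v) = 0.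
  rewrite /rdot gP -?(scalar_of_real0 (k := k)) ?scalar_ofK //.
  by apply: VD => //; rewrite -scaleN1r; exact: VZ.
have := rnormD_sqr (f - g) (g - v); rewrite subrKA gv mul0rn addr0 => E.
rewrite -(@ler_sqr R) ?nnegrE ?rnorm_ge0 // E lerDl sqr_ge0 //.
Qed.

Lemma kernel_span_homo (x : nat -> X) m n : (m <= n)%N ->
  kernel_span (H := H) x m `<=` kernel_span x n.
Proof.
move=> /subnK <-; elim: (n - m)%N => // j IHj u /IHj xu.
rewrite addSn kernel_spanS; exists u => //; exists 0 => //.
by rewrite scale0r addr0.
Qed.

Definition seq_span (x : nat -> X) : set H := \bigcup_n kernel_span x n.

(** The projections lie in the spans, which gives one direction. Conversely, an approximant from the
    [m]-th span stays in all later spans, where the projection is at least as close to [f]. *)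
Lemma orth_proj_cvgP (x : nat -> X) f :
  ((fun n => orth_proj (kernel_span x n) f) @ \oo --> f) <->
  rclosure (seq_span x) f.
Proof.
have pK n := @projectable_kernel_span x n; split=> [|xf].
  move=> /rnorm_cvgP xf e /xf[n _ /(_ n (leqnn n)) fn].
  exists (orth_proj (kernel_span x n) f) => //.
  by exists n => //; exact: orth_proj_mem.
apply/rnorm_cvgP => e /xf[v [m _ xmv] fv]; exists m => // n /= mn.
apply: le_lt_trans fv; apply: orth_proj_le => //.
  exact: lin_subspace_kernel_span.
exact: kernel_span_homo xmv.
Qed.

Lemma lin_subspace_seq_span (x : nat -> X) : lin_subspace (seq_span x).
Proof.
have linK n := lin_subspace_kernel_span x n; split.
- by exists 0%N => //; case: (linK 0%N).
- move=> u v [m _ xu] [n _ xv]; exists (maxn m n) => //.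
  have [_ KD _] := linK (maxn m n).
  by apply: KD; [apply: kernel_span_homo xu; exact: leq_maxl
                |apply: kernel_span_homo xv; exact: leq_maxr].
- by move=> c v [n _ xv]; exists n => //; have [_ _] := linK n; exact.
Qed.

Lemma seq_span_kernel_at (x : nat -> X) i : seq_span x (kernel_at H (x i)).
Proof.
exists i.+1 => //; rewrite kernel_spanS; exists 0.
  by case: (lin_subspace_kernel_span x i).
by exists 1 => //; rewrite scale1r add0r.
Qed.

End inner_product.
Arguments seq_span {R k X} H x.

(** * Separability and weakly measurable maps *)

Lemma separable_seq {R : realType} {k : scalar_kind}
    (V : normedModType (scalar R k)) : separable V ->
  exists D : nat -> V, forall v (e : R), 0 < e -> exists n, rnorm (v - D n) < e.
Proof.
move=> [A cA dA]; have [A0|[D]] := pfcard_geP cA.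
  have [w] := dense_rnorm (0 : V) dA (ltr01 : 0 < 1 :> R).
  by rewrite A0.
exists D => v e e0; have [w Aw vw] := dense_rnorm v dA e0.
by have [n _ Dn] := @surj _ _ _ _ D w Aw; exists n; rewrite Dn.
Qed.

Section weakly_measurable.
Context {R : realType} {k : scalar_kind} {X : Type} (H : rkhs R k X).
Context {d : measure_display} {T : measurableType d}.
Implicit Types F G : T -> H.

(** Real parts suffice: over the complex numbers the imaginary part of <F t, e> is the real part of
    <F t, i e>. *)
Definition weakly_measurable F :=
  forall e : H, measurable_fun [set: T] (fun t => rdot (F t) e).

Lemma weakly_measurable_cst (v : H) : weakly_measurable (fun=> v).
Proof. by move=> e; exact: measurable_cst. Qed.

Lemma weakly_measurableD F G : weakly_measurable F -> weakly_measurable G ->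
  weakly_measurable (fun t => F t + G t).
Proof.
move=> mF mG e; under eq_fun do rewrite rdotDl.
exact: measurable_funD.
Qed.

Lemma weakly_measurableZ (c : scalar R k) F : weakly_measurable F ->
  weakly_measurable (fun t => c *: F t).
Proof. by move=> mF e; under eq_fun do rewrite rdotZl; exact: mF. Qed.

Lemma weakly_measurableN F : weakly_measurable F ->
  weakly_measurable (fun t => - F t).
Proof.
by move=> mF; under eq_fun do rewrite -scaleN1r; exact: weakly_measurableZ.
Qed.

Lemma weakly_measurable_sum I (s : seq I) (F : I -> T -> H) :
  (forall i, weakly_measurable (F i)) ->
  weakly_measurable (fun t => \sum_(i <- s) F i t).
Proof.
move=> mF; elim: s => [|i s IHs].
  by under eq_fun do rewrite big_nil; exact: weakly_measurable_cst.
by under eq_fun do rewrite big_cons; exact: weakly_measurableD.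
Qed.

(* In a separable Hilbert space, [a < |v|] is witnessed by
   [a |e| < Re <v, e>] for some [e] in a countable dense set. *)
Lemma measurable_rnorm F : separable H -> weakly_measurable F ->
  measurable_fun [set: T] (fun t => rnorm (F t)).
Proof.
move=> /separable_seq[D dD] mF.
apply: (measurability _ (RGenOInfty.measurableE R)) => _ [_ [a ->] <-].
rewrite setTI; have [a0|a0] := ltP a 0.
  rewrite (_ : _ @^-1` _ = setT) //; apply/seteqP; split=> // t _ /=.
  by rewrite in_itv /= andbT (lt_le_trans a0) ?rnorm_ge0.
rewrite (_ : _ @^-1` _ =
    \bigcup_n [set t | a * rnorm (D n) < rdot (F t) (D n)]).
  apply: bigcupT_measurable => n; rewrite -[X in measurable X]setTI.
  exact: measurable_fun_ltr.
apply/seteqP; split=> t /=; rewrite in_itv /= andbT.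
  move=> aF; set v := F t in aF *.
  have v0 : 0 < rnorm v by exact: le_lt_trans aF.
  (* If |v - D n| < r, then Re <v, D n> is at least |v|^2 - |v| r up to strictness, while a |D n| is
     at most a (|v| + r). The two bounds coincide for this choice of r. *)
  have [|n vn] := dD v (rnorm v * (rnorm v - a) / (rnorm v + a)).
    by rewrite divr_gt0 ?mulr_gt0 ?subr_gt0 // ltr_pwDl.
  exists n => //=; rewrite ltr_pdivlMr ?ltr_pwDl // in vn.
  have le1 : rnorm (D n) <= rnorm v + rnorm (v - D n).
    by rewrite -{1}(subKr v (D n)) -[rnorm (v - D n)]rnormN rnormD.
  have := rdot_le_norm v (v - D n).
  have -> : rdot v (v - D n) = rnorm v ^+ 2 - rdot v (D n).
    by rewrite rdotDr rdotNr rdotvv.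
  by nra.
move=> [n _ /= lt1]; have := lt_le_trans lt1 (rdot_le_norm _ _).
have [->|Dn0] := eqVneq (rnorm (D n)) 0; first by rewrite !mulr0 ltxx.
by rewrite ltr_pM2r // lt_neqAle eq_sym Dn0 rnorm_ge0.
Qed.

Lemma measurable_rnorm_lt F (r : R) : separable H -> weakly_measurable F ->
  measurable [set t | rnorm (F t) < r].
Proof.
move=> sepH mF; rewrite -[X in measurable X]setTI.
by apply: measurable_fun_ltr => //; exact: measurable_rnorm.
Qed.

End weakly_measurable.

Lemma weakly_measurable_comp {R : realType} {k : scalar_kind} {X : Type}
    (H : rkhs R k X) {d d' : measure_display} {T : measurableType d}
    {T' : measurableType d'} (F : T -> H) (phi : T' -> T) :
  measurable_fun [set: T'] phi -> weakly_measurable F ->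
  weakly_measurable (F \o phi).
Proof. by move=> mphi mF e; exact: measurableT_comp (mF e) mphi. Qed.

(** * Closed subspaces containing almost every K_p, and weak measurability of the kernel map *)

Section kernel_measurability.
Context {R : realType} {k : scalar_kind} {d : measure_display}.
Context {X : measurableType d} (P : probability X R) (H : rkhs R k X).
Hypothesis mK : measurable_rkhs_kernel H.

Lemma measurable_borel_mulr (c : scalar R k) :
  measurable_fun setT ( *%R c : borel (scalar R k) -> borel (scalar R k)).
Proof.
refine (@measurability _ _ (borel (scalar R k)) (borel (scalar R k)) setT _
  (@open (scalar R k)) _ _) => // _ [A oA <-].
rewrite setTI; apply: sub_sigma_algebra.
exact: (continuousP _).1 (@mulrl_continuous _ c) _ oA.
Qed.

Hypothesis hdense : dense (kernel_operator_range P mK).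

(** Off [N] the integrand [l p *: kernel_at H p] lies in [W], hence so does its Bochner integral;
    thus [W] contains the dense set H_P. It serves twice: for a fixed [W] with [N] empty, and for
    the closed span of a sample. *)
Lemma ae_kernel_at_full (W : set H) (N : set X) :
  lin_subspace W -> rclosure W `<=` W -> measurable N -> P N = 0%E ->
  (forall p, ~ N p -> W (kernel_at H p)) -> forall f, W f.
Proof.
move=> linW clW mN PN0 WK f; apply: (clW) => e e0.
have [_ [l _ <-] fl] := dense_rnorm f hdense e0.
exists (kernel_operator P H l) => //.
apply: (bochner_integral_mem linW clW mN PN0) => p Np.
by case: linW => _ _ WZ; exact/WZ/WK.
Qed.

Lemma weakly_measurable_kernel_at : weakly_measurable (kernel_at H).
Proof.
(* Quantifying over [c] makes [W] stable under complex multiples, since the real part of <K_p, e>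
   does not determine that of <K_p, c e>. *)
pose W : set H := [set e | forall c : scalar R k,
  measurable_fun setT (fun p => rdot (kernel_at H p) (c *: e))].
suff WT f : W f by move=> e; have := WT e 1; under eq_fun do rewrite scale1r.
apply: (ae_kernel_at_full (N := set0)) => //.
- split=> [c|u v Wu Wv c|a v Wv c].
  + under eq_fun do rewrite scaler0 /rdot linear0r.
    exact: measurable_cst.
  + under eq_fun do rewrite scalerDr rdotDr.
    exact: measurable_funD.
  + by under eq_fun do rewrite scalerA; exact: Wv.
(* Closedness: by Cauchy-Schwarz the pairings with [c *: w n] converge pointwise in [p], and a
   pointwise limit of measurable functions is measurable. *)
- move=> e We c.
  have /choice[w wP] n : exists w, W w /\ rnorm (e - w) < n.+1%:R^-1.
    by have [|w] := We n.+1%:R^-1 _; [rewrite invr_gt0|exists w].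
  apply: (@measurable_fun_cvg _ _ _ _
      (fun n p => rdot (kernel_at H p) (c *: w n))).
    by move=> n; have [Ww _] := wP n; exact: Ww.
  move=> p _; apply/cvgrPdist_le => eps eps0.
  set b := rnorm (kernel_at H p) * rnorm (c : (scalar R k)^o).
  have b0 : 0 <= b.
    rewrite mulr_ge0 ?rnorm_ge0 //; exact/scalar_re_ge0/normr_ge0.
  have [n0 n0P] : exists n, 0 + n.+1%:R^-1 < eps / (b + 1).
    by apply: ltr_add_invr; rewrite divr_gt0 // ltr_wpDl.
  exists n0 => // n /= n0n; rewrite -rdotNr -rdotDr -scalerBr.
  have rle x : rdot (kernel_at H p) (c *: x) <= b * rnorm x.
    by rewrite -mulrA -rnormZ rdot_le_norm.
  have le_eps : b * rnorm (e - w n) <= eps.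
    have [_ lt1] := wP n; rewrite add0r ltr_pdivlMr ?ltr_wpDl // in n0P.
    have le2 : (n.+1%:R^-1 : R) <= n0.+1%:R^-1.
      by rewrite lef_pV2 ?posrE // ler_nat.
    apply/ltW; apply: le_lt_trans n0P.
    rewrite mulrC ler_pM ?rnorm_ge0 ?lerDl //.
    exact: le_trans (ltW lt1) le2.
  rewrite ler_norml (le_trans (rle _)) // andbT lerNl -rdotNr -scalerN.
  by rewrite (le_trans (rle _)) // rnormN.
(* For e = K_q the reproducing property turns the pairing into the real part of
   [c * rkhs_kernel H (p, q)], which involves a section of the measurable kernel. *)
move=> q _ c.
under eq_fun do rewrite rdotC /rdot dotZl -reproducing kernel_atE.
apply: (@measurableT_comp _ _ _ _ _ _ (scalar_re : borel (scalar R k) -> R)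
  _ (fun p => c * rkhs_kernel H (p, q) : borel (scalar R k))).
  exact: measurable_scalar_re.
apply: measurableT_comp (measurable_borel_mulr c) _.
apply: (@measurableT_comp _ _ _ _ _ _
  (rkhs_kernel H : X * X -> borel (scalar R k)) _ (fun x => (x, q))) => //.
Qed.

End kernel_measurability.

(** * Rational combinations and measurability of the convergence events *)

Definition scalar_of_rat {R : realType} (k : scalar_kind) :
    rat * rat -> scalar R k :=
  match k with
  | RealScalars => fun q => ratr q.1 : R
  | ComplexScalars => fun q => Complex (ratr q.1 : R) (ratr q.2)
  end.

Lemma scalar_of_rat_dense {R : realType} {k : scalar_kind} (z : scalar R k)
    (e : R) : 0 < e ->
  exists q, rnorm (z - scalar_of_rat k q : (scalar R k)^o) < e.
Proof.
have near (a eps : R) : 0 < eps -> exists q : rat, `|a - ratr q| < eps.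
  move=> eps0; have [|q] := @rat_in_itvoo R (a - eps) (a + eps).
    by rewrite ltrD2l (lt_trans _ eps0) // oppr_lt0.
  rewrite in_itv /= => /andP[lo hi]; exists q.
  by rewrite ltr_norml; apply/andP; split; lra.
case: k z => /= z e0.
  by have [q zq] := near z e e0; exists (q, 0).
case: z => a b; have e20 : 0 < e / 2 by rewrite divr_gt0.
have [q aq] := near a _ e20; have [r br] := near b _ e20.
exists (q, r); rewrite /rnorm.
have -> : Complex a b - Complex (ratr q : R) (ratr r) =
  Complex (a - ratr q) 0 + Complex 0 (b - ratr r).
  by apply/eqP; rewrite eq_complex /= addr0 add0r !eqxx.
have := ler_normD (Complex (a - ratr q) 0) (Complex 0 (b - ratr r)).
have -> : `|Complex (a - ratr q) 0| = real_complex R `|a - ratr q|.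
  by rewrite normc_def /= expr0n addr0 sqrtr_sqr.
have -> : `|Complex 0 (b - ratr r)| = real_complex R `|b - ratr r|.
  by rewrite normc_def /= expr0n add0r sqrtr_sqr.
rewrite -rmorphD [leLHS](@ge0_scalarE R ComplexScalars) ?normr_ge0 // lecR.
by move=> le1; apply: le_lt_trans le1 _; rewrite (splitr e) ltrD.
Qed.

Section random_span.
Context {R : realType} {k : scalar_kind} {d : measure_display}.
Context {X : measurableType d} (P : probability X R) (H : rkhs R k X).

Lemma measurable_coord i : measurable_fun [set: seq_space X] (fun x => x i).
Proof.
move=> _ A mA; rewrite setTI; apply: sub_sigma_algebra; exists i => //.
by exists A => //; rewrite setTI.
Qed.

(** The coefficient lists form a countable type that does not depend on the sample, so unions over
    them preserve measurability. *)
Definition rat_comb (c : seq (rat * rat)) (x : nat -> X) : H :=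
  \sum_(i < size c) scalar_of_rat k (nth (0, 0) c i) *: kernel_at H (x i).

Lemma rat_comb_span c x : seq_span H x (rat_comb c x).
Proof.
by exists (size c) => //; exists (fun i => scalar_of_rat k (nth (0, 0) c i)).
Qed.

Lemma rat_comb_rcons c q x : rat_comb (rcons c q) x =
  rat_comb c x + scalar_of_rat k q *: kernel_at H (x (size c)).
Proof.
rewrite /rat_comb size_rcons big_ord_recr /= nth_rcons ltnn eqxx.
by congr (_ + _); apply: eq_bigr => i _; rewrite nth_rcons ltn_ord.
Qed.

(** The induction keeps track of [size c = n] because a coefficient appended to [c] multiplies the
    kernel function at [x (size c)]. *)
Lemma rat_comb_dense x n u (e : R) : kernel_span (H := H) x n u -> 0 < e ->
  exists2 c, size c = n & rnorm (u - rat_comb c x) < e.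
Proof.
elim: n u e => [|n IHn] u e.
  move=> [c ->] e0; exists [::] => //.
  by rewrite /rat_comb !big_ord0 subrr rnorm0.
rewrite kernel_spanS => -[v xv [a _ <-]] e0.
have e20 : 0 < e / 2 by rewrite divr_gt0.
have [c cn vc] := IHn _ _ xv e20.
set K := kernel_at H (x n); have K1 : 0 < rnorm K + 1.
  by rewrite ltr_wpDl // rnorm_ge0.
have [q aq] := scalar_of_rat_dense a (divr_gt0 e20 K1).
exists (rcons c q); first by rewrite size_rcons cn.
rewrite rat_comb_rcons cn -/K opprD addrACA -scalerBl.
rewrite (le_lt_trans (rnormD _ _)) // (splitr e) ltrD // rnormZ.
rewrite ltr_pdivlMr // in aq; apply: le_lt_trans aq.
by rewrite ler_wpM2l ?lerDl //; exact/scalar_re_ge0/normr_ge0.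
Qed.

Hypothesis sepH : separable H.
Hypothesis wmK : weakly_measurable (kernel_at H).

Lemma measurable_rclosure_seq_span f :
  measurable [set x : seq_space X | rclosure (seq_span H x) f].
Proof.
rewrite (_ : [set x | _] = \bigcap_m \bigcup_(c : seq (rat * rat))
    [set x : seq_space X | rnorm (f - rat_comb c x) < m.+1%:R^-1]).
  apply: bigcapT_measurable => m.
  apply: countable_bigcupT_measurable => // c.
  apply: measurable_rnorm_lt => //.
  apply: weakly_measurableD; first exact: weakly_measurable_cst.
  apply: weakly_measurableN; apply: weakly_measurable_sum => i.
  apply: weakly_measurableZ.
  exact: weakly_measurable_comp (measurable_coord _) wmK.
apply/seteqP; split=> x /=.
  move=> xf m _; have m0 : 0 < (m.+1%:R^-1 : R) / 2 by rewrite divr_gt0.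
  have [v [n _ xv] fv] := xf _ m0; have [c _ vc] := rat_comb_dense xv m0.
  exists c => //=; rewrite (le_lt_trans (rdist_triangle v _ _)) //.
  by rewrite (splitr m.+1%:R^-1) ltrD.
move=> xf e /ltr_add_invr[m]; rewrite add0r => me.
have [c _ /= fc] := xf m I; exists (rat_comb c x); first exact: rat_comb_span.
exact: lt_trans fc me.
Qed.

(** * Independent samples visit every set of positive probability *)

Variable PN : probability (seq_space X) R.
Hypothesis hPN : is_countable_power P PN.

(** By independence the first [n] points all miss [A] with probability (1 - P A)^n, which tends to
    0. *)
Lemma ae_visits (A : set X) : measurable A -> P A <> 0%E ->
  {ae PN, forall x : seq_space X, exists i, A (x i)}.
Proof.
move=> mA PA0; have [hlaw hind] := hPN.
pose B n : set (seq_space X) :=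
  [set x : seq_space X |
    forall i, i \in [fset j in iota 0 n]%fset -> (~` A) (x i)].
have PNB n : PN (B n) = ((fine (P (~` A))) ^+ n)%:E.
  have -> : PN (B n) = _ := hind _ (fun=> ~` A) (fun=> measurableC mA).
  rewrite (eq_bigr (fun=> (fine (P (~` A)))%:E)) => [|i _]; last first.
    by rewrite hlaw ?fineK ?fin_num_measure //; exact: measurableC.
  rewrite prodEFin big_const_seq count_predT.
  rewrite (perm_size (_ : perm_eq _ (iota 0 n))) ?size_iota.
    by rewrite -Monoid.iteropE.
  apply: uniq_perm; [exact: fset_uniq|exact: iota_uniq|move=> i].
  by rewrite !inE.
have q1 : `|fine (P (~` A))| < 1.
  rewrite ger0_norm ?fine_ge0 // -lte_fin fineK ?fin_num_measure //; last first.
    exact: measurableC.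
  rewrite probability_setC // lte_subel_addl ?fin_num_measure //.
  rewrite -[ltLHS]add0e lte_leD // lt_neqAle measure_ge0 andbT eq_sym.
  exact/eqP.
have mC i : measurable [set x : seq_space X | (~` A) (x i)].
  rewrite -[X in measurable X]setTI; apply: (measurable_coord i) => //.
  exact: measurableC.
have mB n : measurable (B n).
  rewrite (_ : B n = \bigcap_(i in [set` [fset j in iota 0 n]%fset])
      [set x : seq_space X | (~` A) (x i)]) //.
  by apply: fin_bigcap_measurable => //; exact: finite_fset.
pose C := \bigcap_i [set x : seq_space X | (~` A) (x i)].
have mCC : measurable C by exact: bigcapT_measurable.
exists C; split => //; last first.
  by move=> x /= nAx i _ /= Ax; apply: nAx; exists i.
(* Were [PN C] positive, some [PN (B n)] would be smaller, although [C] is contained in [B n]. *)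
apply/eqP; rewrite eq_le measure_ge0 andbT leNgt; apply/negP => C0.
have C0' : 0 < fine (PN C) by rewrite fine_gt0 // C0 ltey_eq fin_num_measure.
have /cvgr_lt/(_ _ C0')[n _ /(_ n (leqnn n)) /=] := cvg_expr q1.
rewrite -lte_fin fineK ?fin_num_measure // -PNB ltNge => /negP; apply.
by apply: le_measure => [||x Cx i _]; [exact/mem_set|exact/mem_set|exact: Cx].
Qed.

End random_span.

(** * Almost sure density of the sampled span, and the theorem *)

Section main.
Context {R : realType} {k : scalar_kind} {d : measure_display}.
Context {X : measurableType d} (P : probability X R) (H : rkhs R k X).
Variable PN : probability (seq_space X) R.
Hypothesis hPN : is_countable_power P PN.
Hypothesis sepH : separable H.
Hypothesis mK : measurable_rkhs_kernel H.
Hypothesis hdense : dense (kernel_operator_range P mK).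

Lemma ae_seq_span_dense :
  {ae PN, forall x : seq_space X, forall f, rclosure (seq_span H x) f}.
Proof.
have wmK := weakly_measurable_kernel_at hdense.
have [D dD] := separable_seq sepH.
pose A n m : set X := [set p | rnorm (kernel_at H p - D n) < m.+1%:R^-1].
have mA n m : measurable (A n m).
  apply: measurable_rnorm_lt => //.
  exact: weakly_measurableD wmK (weakly_measurable_cst _).
(* There are countably many pairs [n], [m], so a single almost sure event serves all of them. *)
have : {ae PN, forall x : seq_space X, forall n m,
    P (A n m) <> 0%E -> exists i, A n m (x i)}.
  apply: ae_foralln => n; apply: ae_foralln => m.
  have [PA0|PA0] := pselect (P (A n m) = 0%E); first by near=> x.
  by apply: filterS (ae_visits hPN (mA n m) PA0) => x xA _.
apply: filterS => x xA.
have linW := lin_subspace_rclosure (lin_subspace_seq_span H x).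
(* [N] gathers the null sets among the [A n m], so every [A n m] containing a point outside [N] has
   positive probability and is visited. *)
pose N := \bigcup_n \bigcup_m (if P (A n m) == 0%E then A n m else set0).
apply: (ae_kernel_at_full hdense (N := N)) => //.
- exact: rclosureK.
- apply: bigcupT_measurable => n; apply: bigcupT_measurable => m.
  by case: ifP.
- apply/negligibleP.
    apply: bigcupT_measurable => n; apply: bigcupT_measurable => m.
    by case: ifP.
  apply: negligible_bigcup => n; apply: negligible_bigcup => m.
  case: ifPn => [/eqP PA0|_]; last exact: negligible_set0.
  exact/negligibleP.
move=> p Np e e0.
(* K_p and some K_(x i) will lie in a common ball of radius below [e / 2], centred at a point of the
   dense sequence. *)
have [m] : exists m, 0 + m.+1%:R^-1 < e / 2.
  by apply: ltr_add_invr; rewrite divr_gt0.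
rewrite add0r => me; have m0 : 0 < m.+1%:R^-1 :> R by rewrite invr_gt0.
have [n pn] := dD (kernel_at H p) _ m0.
have [i xi] : exists i, A n m (x i).
  apply: xA => PA0; apply: Np; exists n => //; exists m => //.
  by rewrite PA0 eqxx.
exists (kernel_at H (x i)); first exact: seq_span_kernel_at.
rewrite (le_lt_trans (rdist_triangle (D n) _ _)) // (splitr e) ltrD //.
  exact: lt_trans pn me.
by rewrite rdistC; exact: lt_trans xi me.
Unshelve. all: by end_near.
Qed.

Lemma ae_probability1 (A : set (seq_space X)) :
  measurable A -> {ae PN, forall x, A x} -> PN A = 1%E.
Proof.
move=> mA /negligibleP; rewrite -/(~` A) => /(_ (measurableC mA)) PNA.
by rewrite -[A]setCK probability_setC ?PNA ?sube0 //; exact: measurableC.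
Qed.

End main.

Theorem theorem3p8 (R : realType) (k : scalar_kind) (d : measure_display)
    (X : measurableType d) (P : probability X R) (H : rkhs R k X)
    (PN : probability (seq_space X) R)
    (hPN : is_countable_power P PN)
    (hsep : separable H)
    (mK : measurable_rkhs_kernel H)
    (hdense : dense (kernel_operator_range P mK)) :
  (forall f : H,
     PN [set x : seq_space X |
          (fun n => orth_proj (kernel_span x n) f) @ \oo --> f] = 1%E) /\
  PN [set x : seq_space X | forall f : H,
       (fun n => orth_proj (kernel_span x n) f) @ \oo --> f] = 1%E.
Proof.
have aeH := ae_seq_span_dense hPN hsep hdense.
have wmK := weakly_measurable_kernel_at hdense.
have cvgE f : [set x : seq_space X |
    (fun n => orth_proj (kernel_span x n) f) @ \oo --> f] =
    [set x : seq_space X | rclosure (seq_span H x) f].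
  by apply/seteqP; split=> x /orth_proj_cvgP.
have mcvg f := measurable_rclosure_seq_span hsep wmK f.
split=> [f|].
  by rewrite cvgE; apply: ae_probability1 => //; apply: filterS aeH => x; exact.
have [D dD] := separable_seq hsep.
(* The closed span is everything as soon as it contains the dense sequence [D]. This rewrites an
   event quantified over all [f] as a countable intersection, hence a measurable set. *)
rewrite (_ : [set x | _] = \bigcap_n
    [set x : seq_space X | rclosure (seq_span H x) (D n)]).
  apply: ae_probability1; first exact: bigcapT_measurable.
  by apply: filterS aeH => x xH n _; exact: xH.
apply/seteqP; split=> x /= xD.
  by move=> n _; exact/orth_proj_cvgP.
move=> f; apply/orth_proj_cvgP/rclosureK => e e0.
by have [n fn] := dD f e e0; exists (D n) => //; exact: xD.
Qed.
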